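(* For all integers $c>0$, $d>0$, $n\ge 0$, all $m\in\mathbb{N}$ and all $\lambda,\mu,\nu\in\mathbb{C}$, the following symmetry identity, in the variables $x,y,X,Y$, holds for the 2-variable truncated exponential Apostol type polynomials ${}_{e^{(r)}}\mathcal{F}_n^{(m)}(x,y;\lambda;\mu,\nu)$: $$\sum_{k=0}^{n}\sum_{l=0}^{k}\binom{n}{k}\binom{k}{l}c^{n-k}d^{\nu+k}\,{}_{e^{(r)}}\mathcal{F}_{n-k}^{(m)}(dx,d^{r}y;\lambda;\mu,\nu)\,\mathcal{S}_{l}(c-1,-\lambda)\,{}_{e^{(r)}}\mathcal{F}_{k-l}^{(m-1)}(cX,c^{r}Y;\lambda;\mu,\nu)$$ $$=\sum_{k=0}^{n}\sum_{l=0}^{k}\binom{n}{k}\binom{k}{l}d^{n-k}c^{\nu+k}\,{}_{e^{(r)}}\mathcal{F}_{n-k}^{(m)}(cx,c^{r}y;\lambda;\mu,\nu)\,\mathcal{S}_{l}(d-1,-\lambda)\,{}_{e^{(r)}}\mathcal{F}_{k-l}^{(m-1)}(dX,d^{r}Y;\lambda;\mu,\nu).$$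
   Context: Here $\mathbb{N}=\{1,2,\dots\}$ and $r$ is the (positive integer) index of the 2-variable truncated exponential polynomials $e_n^{(r)}(x,y)$, whose generating function is $\frac{e^{xt}}{1-yt^r}$. The 2-variable truncated exponential Apostol type polynomials ${}_{e^{(r)}}\mathcal{F}_n^{(m)}(x,y;\lambda;\mu,\nu)$ of order $m$ (with $m=0$ also allowed) are defined by the generating function $$\Big(\frac{2^\mu t^\nu}{\lambda e^{t}+1}\Big)^m \frac{e^{xt}}{1-yt^r}=\sum_{n=0}^{\infty}{}_{e^{(r)}}\mathcal{F}_n^{(m)}(x,y;\lambda;\mu,\nu)\frac{t^{n}}{n!}.$$ For an arbitrary real or complex number $a$, the generalized sums of integer powers $\mathcal{S}_k(n,a)$ are defined by $$\sum_{k=0}^{\infty}\mathcal{S}_{k}(n,a)\frac{t^k}{k!}=\frac{a e^{(n+1)t}-1}{a e^{t}-1}.$$ *)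

(* Defs.v *)
From Stdlib Require Export Reals Factorial.
From Coquelicot Require Export Coquelicot.

Open Scope C_scope.

Definition Cexp (z : C) : C :=
  (exp (Re z) * cos (Im z), exp (Re z) * sin (Im z))%R.

(* Principal argument, in (-PI, PI]; only meaningful for z <> 0. *)
Definition Carg (z : C) : R :=
  if Rle_dec 0 (Im z) then acos (Re z / Cmod z) else (- acos (Re z / Cmod z))%R.

Definition Cln (z : C) : C := (ln (Cmod z), Carg z).

(* Principal value of z ^ w for a complex exponent w; only meaningful for
   z <> 0. Natural exponents use Coquelicot's [Cpow], written [z ^ n]. *)
Definition Cpower (z w : C) : C := Cexp (w * Cln z).

(* [is_egf a g]: g(t) = sum_n a_n t^n / n! for all t <> 0 near 0. The point
   t = 0 is left out because the closed forms below may be 0/0 there (for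
   instance (e^((n+1)t) - 1) / (e^t - 1)); continuity settles that value, and
   the sequence a is determined by g. *)
Definition is_egf (a : nat -> C) (g : C -> C) : Prop :=
  locally' (0 : C) (fun t : C =>
    is_pseries (K := C_AbsRing) (V := C_NormedModule)
      (fun n : nat => a n / INR (fact n)) t (g t)).

(* [F n x y] are the 2-variable truncated exponential Apostol type polynomials
   of index r, order m and parameters lam, mu, nu. The exponent nu is an
   arbitrary complex number, so t ^ nu is the principal power: such an F exists
   exactly when the left-hand side of the defining equation does expand in
   non-negative integral powers of t. *)
Definition is_trunc_exp_apostol (r : nat) (lam mu nu : C) (m : nat)
    (F : nat -> C -> C -> C) : Prop :=
  forall x y : C,
    is_egf (fun n => F n x y)
      (fun t => ((Cpower 2 mu * Cpower t nu) / (lam * Cexp t + 1)) ^ m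
                * (Cexp (x * t) / (1 - y * t ^ r))).

(* [s k] is the generalized sum of integer powers S_k(n, a). *)
Definition is_gen_power_sum (n : nat) (a : C) (s : nat -> C) : Prop :=
  is_egf s
    (fun t => (a * Cexp (INR (n + 1) * t) - 1) / (a * Cexp t - 1)).

(* Main.v *)
Require Import Defs.
From Stdlib Require Import Lra Lia.

(* Up to n!, the two sides are the n-th coefficients of
     d^nu S(c-1, -lam)(dt) F^(m-1)(cX, c^r Y)(dt) F^(m)(dx, d^r y)(ct)
   and of the same product with c and d exchanged. Since
     S(c-1, -lam)(dt) = (lam e^(cdt) + 1) / (lam e^(dt) + 1)
   and (ct)^nu = c^nu t^nu for c > 0, this product is symmetric in c and d; it
   remains to multiply power series and to compare coefficients. Denominators
   are never cleared, so that their zeros play no role. *)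

(** * Real power series with positive radius of convergence *)

Lemma CV_radius_pos_of_ex_pseries (a : nat -> R) (t : R) :
  t <> 0%R -> ex_pseries (K := R_AbsRing) (V := R_NormedModule) a t -> Rbar_lt 0 (CV_radius a).
Proof.
  intros Ht Ha.
  apply Rbar_not_le_lt; intros Hle.
  (* With radius at most 0, [t] would lie outside the disk of convergence, where the terms do not
     tend to 0; those of a convergent series do. *)
  apply (CV_disk_outside a t).
  - apply Rbar_le_lt_trans with 0%R; [exact Hle | exact (Rabs_pos_lt t Ht)].
  - apply is_lim_seq_ext with (fun n => scal (pow_n t n) (a n)).
    + intros n; rewrite pow_n_pow; apply Rmult_comm.
    + exact (ex_series_lim_0 _ Ha).
Qed.

Lemma CV_radius_pos_of_locally (a : nat -> R) :
  locally' 0%R (fun t : R => ex_pseries (K := R_AbsRing) (V := R_NormedModule) a t) ->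
  Rbar_lt 0 (CV_radius a).
Proof.
  intros [e He].
  assert (Hp := cond_pos e).
  apply (CV_radius_pos_of_ex_pseries a (e / 2)); [lra |].
  apply He; [| lra].
  change (Rabs (e / 2 - 0) < e)%R; rewrite Rabs_pos_eq; lra.
Qed.

Lemma locally_lt_CV_radius (a : nat -> R) :
  Rbar_lt 0 (CV_radius a) ->
  locally 0%R (fun t : R => Rbar_lt (Rabs t) (CV_radius a)).
Proof.
  intros Ha.
  destruct (CV_radius a) as [ra | |]; simpl in Ha; [| | contradiction].
  - exists (mkposreal ra Ha); intros t Ht.
    change (Rabs (t - 0) < ra)%R in Ht; rewrite Rminus_0_r in Ht; exact Ht.
  - apply filter_forall; intros t; exact I.
Qed.

Lemma locally'_of_locally (P : R -> Prop) : locally 0%R P -> locally' 0%R P.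
Proof. intros [e He]; exists e; auto. Qed.

(** * Expansions along the real axis and uniqueness of their coefficients *)

Definition re_series (a : nat -> C) (n : nat) : R := Re (a n).
Definition im_series (a : nat -> C) (n : nat) : R := Im (a n).

(* Restricting to a real variable splits a complex power series into two real
   ones, to which Coquelicot's theory of [PSeries] applies. *)
Definition real_expansion (a : nat -> C) (g : R -> C) : Prop :=
  Rbar_lt 0 (CV_radius (re_series a)) /\ Rbar_lt 0 (CV_radius (im_series a)) /\
  locally' 0%R (fun t : R => g t = (PSeries (re_series a) t, PSeries (im_series a) t)).

Lemma PSeries_punctured_ext_recip (a b : nat -> R) (n : nat) :
  Rbar_lt 0 (CV_radius a) -> Rbar_lt 0 (CV_radius b) ->
  locally' 0%R (fun t : R => PSeries a t = PSeries b t) -> a n = b n.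
Proof.
  intros Ha Hb [e He].
  (* Multiplying both series by t makes them agree at t = 0 as well. *)
  apply (PSeries_ext_recip (PS_incr_1 a) (PS_incr_1 b) (S n)).
  - rewrite CV_radius_incr_1; exact Ha.
  - rewrite CV_radius_incr_1; exact Hb.
  - exists e; intros t Ht; rewrite !PSeries_incr_1.
    destruct (Req_dec t 0) as [-> | Hn]; [ring |].
    rewrite (He t Ht Hn); reflexivity.
Qed.

Lemma real_expansion_unique (a b : nat -> C) (g : R -> C) :
  real_expansion a g -> real_expansion b g -> forall n, a n = b n.
Proof.
  intros (Ha1 & Ha2 & Ha) (Hb1 & Hb2 & Hb) n.
  assert (H := filter_and _ _ Ha Hb).
  apply injective_projections.
  - apply (PSeries_punctured_ext_recip (re_series a) (re_series b)); auto.
    revert H; apply filter_imp; intros t [H1 H2]; congruence.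
  - apply (PSeries_punctured_ext_recip (im_series a) (im_series b)); auto.
    revert H; apply filter_imp; intros t [H1 H2]; congruence.
Qed.

(** Agreement off 0 suffices, because [real_expansion] constrains [g] only there. The closed forms
    are compared this way, since principal powers split as products only at nonzero arguments. *)
Lemma real_expansion_ext (a b : nat -> C) (g h : R -> C) :
  (forall n, a n = b n) -> (forall t, t <> 0%R -> g t = h t) ->
  real_expansion a g -> real_expansion b h.
Proof.
  intros Hab Hgh (H1 & H2 & H).
  assert (Er : forall n, re_series a n = re_series b n)
    by (intros n; unfold re_series; now rewrite Hab).
  assert (Ei : forall n, im_series a n = im_series b n)
    by (intros n; unfold im_series; now rewrite Hab).
  split; [| split].
  - now rewrite <- (CV_radius_ext _ _ Er).
  - now rewrite <- (CV_radius_ext _ _ Ei).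
  - destruct H as [e He]; exists e; intros t Ht Hn.
    rewrite <- (Hgh t Hn), (He t Ht Hn), (PSeries_ext _ _ t Er), (PSeries_ext _ _ t Ei).
    reflexivity.
Qed.

(** * From complex generating functions to real expansions *)

Lemma Re_sum_n (u : nat -> C) (n : nat) : Re (sum_n u n) = sum_n (fun k => Re (u k)) n.
Proof.
  induction n as [| n IH]; [now rewrite !sum_O |].
  rewrite !sum_Sn, <- IH; reflexivity.
Qed.

Lemma Im_sum_n (u : nat -> C) (n : nat) : Im (sum_n u n) = sum_n (fun k => Im (u k)) n.
Proof.
  induction n as [| n IH]; [now rewrite !sum_O |].
  rewrite !sum_Sn, <- IH; reflexivity.
Qed.

Lemma is_series_Re (u : nat -> C) (l : C) :
  is_series (K := C_AbsRing) (V := C_NormedModule) u l ->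
  is_series (K := R_AbsRing) (V := R_NormedModule) (fun n => Re (u n)) (Re l).
Proof.
  intros H; unfold is_series.
  apply filterlim_ext with (fun n => Re (sum_n u n)).
  - intros n; apply Re_sum_n.
  - apply (filterlim_comp _ _ _ _ _ _ _ _ H).
    (* Balls of [C] are products of real balls, so the same radius serves for the real part. *)
    intros P [e He]; exists e; intros z Hz; apply He, Hz.
Qed.

Lemma is_series_Im (u : nat -> C) (l : C) :
  is_series (K := C_AbsRing) (V := C_NormedModule) u l ->
  is_series (K := R_AbsRing) (V := R_NormedModule) (fun n => Im (u n)) (Im l).
Proof.
  intros H; unfold is_series.
  apply filterlim_ext with (fun n => Im (sum_n u n)).
  - intros n; apply Im_sum_n.
  - apply (filterlim_comp _ _ _ _ _ _ _ _ H).
    intros P [e He]; exists e; intros z Hz; apply He, Hz.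
Qed.

Lemma is_pseries_real (a : nat -> C) (t : R) (l : C) :
  is_pseries (K := C_AbsRing) (V := C_NormedModule) a (t : C) l ->
  is_pseries (K := R_AbsRing) (V := R_NormedModule) (re_series a) t (Re l) /\
  is_pseries (K := R_AbsRing) (V := R_NormedModule) (im_series a) t (Im l).
Proof.
  intros H.
  (* Powers of a real [t] stay real, so multiplication by them commutes with [Re] and [Im]. *)
  assert (E : forall n, pow_n (K := C_Ring) (t : C) n = RtoC (pow_n (K := R_Ring) t n)).
  { induction n as [| n IH]; [reflexivity |].
    change (Cmult (RtoC t) (pow_n (K := C_Ring) (RtoC t) n) = RtoC (t * pow_n (K := R_Ring) t n)).
    rewrite IH, RtoC_mult; reflexivity. }
  split.
  - eapply is_series_ext; [| exact (is_series_Re _ _ H)].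
    intros n; cbv beta.
    change (Re (Cmult (pow_n (K := C_Ring) (RtoC t) n) (a n)) = pow_n (K := R_Ring) t n * Re (a n))%R.
    rewrite E; unfold Re; simpl; ring.
  - eapply is_series_ext; [| exact (is_series_Im _ _ H)].
    intros n; cbv beta.
    change (Im (Cmult (pow_n (K := C_Ring) (RtoC t) n) (a n)) = pow_n (K := R_Ring) t n * Im (a n))%R.
    rewrite E; unfold Im; simpl; ring.
Qed.

Lemma locally'_C_real (P : C -> Prop) :
  locally' (0 : C) P -> locally' 0%R (fun t : R => P (t : C)).
Proof.
  intros [e He]; exists e; intros t Ht Hn.
  apply He.
  - split; [exact Ht | apply ball_center].
  - intros E; apply Hn, (f_equal Re E).
Qed.

(** Passing to real [t] loses nothing for comparing coefficients: by [real_expansion_unique] the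
    values on the real axis near 0 already determine them. *)
Lemma is_egf_real_expansion (a : nat -> C) (g : C -> C) :
  is_egf a g -> real_expansion (fun n => a n / INR (fact n)) (fun t : R => g t).
Proof.
  intros H; apply locally'_C_real in H.
  set (b := fun n => a n / INR (fact n)) in *.
  assert (H' := filter_imp _ _ (fun t h => is_pseries_real b t _ h) H).
  split; [| split].
  - apply CV_radius_pos_of_locally; revert H'; apply filter_imp; intros t [h _]; eexists; exact h.
  - apply CV_radius_pos_of_locally; revert H'; apply filter_imp; intros t [_ h]; eexists; exact h.
  - revert H'; apply filter_imp; intros t [h1 h2].
    rewrite (is_pseries_unique _ _ _ h1), (is_pseries_unique _ _ _ h2).
    apply surjective_pairing.
Qed.

(** * Cauchy products, scalar multiples and dilations of expansions *)

Definition Cconv (a b : nat -> C) (n : nat) : C := sum_n (fun k => a k * b (n - k)%nat) n.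

(** Termwise, this is Re(zw) = Re z Re w - Im z Im w. *)
Lemma re_series_Cconv (a b : nat -> C) (n : nat) :
  re_series (Cconv a b) n =
  PS_minus (PS_mult (re_series a) (re_series b)) (PS_mult (im_series a) (im_series b)) n.
Proof.
  unfold re_series at 1, Cconv.
  rewrite Re_sum_n, sum_n_Reals.
  apply (minus_sum (fun k => re_series a k * re_series b (n - k)%nat)%R
    (fun k => im_series a k * im_series b (n - k)%nat)%R).
Qed.

Lemma im_series_Cconv (a b : nat -> C) (n : nat) :
  im_series (Cconv a b) n =
  PS_plus (PS_mult (re_series a) (im_series b)) (PS_mult (im_series a) (re_series b)) n.
Proof.
  unfold im_series at 1, Cconv.
  rewrite Im_sum_n, sum_n_Reals.
  apply (plus_sum (fun k => re_series a k * im_series b (n - k)%nat)%R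
    (fun k => im_series a k * re_series b (n - k)%nat)%R).
Qed.

Lemma real_expansion_mult (a b : nat -> C) (g h : R -> C) :
  real_expansion a g -> real_expansion b h ->
  real_expansion (Cconv a b) (fun t => g t * h t).
Proof.
  intros (Har & Hai & Ha) (Hbr & Hbi & Hb).
  (* Near 0 all four real series are evaluated strictly inside their disks of convergence, as the
     Cauchy product formula requires. *)
  assert (H : locally 0%R (fun t : R =>
    (Rbar_lt (Rabs t) (CV_radius (re_series a)) /\ Rbar_lt (Rabs t) (CV_radius (im_series a))) /\
    (Rbar_lt (Rabs t) (CV_radius (re_series b)) /\ Rbar_lt (Rabs t) (CV_radius (im_series b))))).
  { repeat apply filter_and; apply locally_lt_CV_radius; assumption. }
  apply locally'_of_locally in H.
  split; [| split].
  - rewrite (CV_radius_ext _ _ (re_series_Cconv a b)).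
    apply CV_radius_pos_of_locally; revert H; apply filter_imp; intros t [[H1 H2] [H3 H4]].
    apply ex_pseries_minus; apply ex_pseries_mult; assumption.
  - rewrite (CV_radius_ext _ _ (im_series_Cconv a b)).
    apply CV_radius_pos_of_locally; revert H; apply filter_imp; intros t [[H1 H2] [H3 H4]].
    apply ex_pseries_plus; apply ex_pseries_mult; assumption.
  - generalize (filter_and _ _ H (filter_and _ _ Ha Hb)); apply filter_imp.
    intros t [[[H1 H2] [H3 H4]] [-> ->]].
    rewrite (PSeries_ext _ _ t (re_series_Cconv a b)), (PSeries_ext _ _ t (im_series_Cconv a b)).
    rewrite PSeries_minus, PSeries_plus by (apply ex_pseries_mult; assumption).
    rewrite !PSeries_mult by assumption.
    reflexivity.
Qed.

Lemma re_series_scal (z : C) (a : nat -> C) (n : nat) :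
  re_series (fun n => z * a n) n =
  PS_minus (PS_scal (Re z) (re_series a)) (PS_scal (Im z) (im_series a)) n.
Proof. reflexivity. Qed.

Lemma im_series_scal (z : C) (a : nat -> C) (n : nat) :
  im_series (fun n => z * a n) n =
  PS_plus (PS_scal (Re z) (im_series a)) (PS_scal (Im z) (re_series a)) n.
Proof. reflexivity. Qed.

Lemma real_expansion_scal (z : C) (a : nat -> C) (g : R -> C) :
  real_expansion a g -> real_expansion (fun n => z * a n) (fun t => z * g t).
Proof.
  intros (Har & Hai & Ha).
  assert (H : locally 0%R (fun t : R =>
    ex_pseries (re_series a) t /\ ex_pseries (im_series a) t)).
  { generalize (filter_and _ _ (locally_lt_CV_radius _ Har) (locally_lt_CV_radius _ Hai)).
    apply filter_imp; intros t [H1 H2]; split; apply CV_radius_inside; assumption. }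
  apply locally'_of_locally in H.
  split; [| split].
  - rewrite (CV_radius_ext _ _ (re_series_scal z a)).
    apply CV_radius_pos_of_locally; revert H; apply filter_imp; intros t [H1 H2].
    apply ex_pseries_minus; apply ex_pseries_scal; try assumption; apply Rmult_comm.
  - rewrite (CV_radius_ext _ _ (im_series_scal z a)).
    apply CV_radius_pos_of_locally; revert H; apply filter_imp; intros t [H1 H2].
    apply ex_pseries_plus; apply ex_pseries_scal; try assumption; apply Rmult_comm.
  - generalize (filter_and _ _ H Ha); apply filter_imp.
    intros t [[H1 H2] ->].
    rewrite (PSeries_ext _ _ t (re_series_scal z a)), (PSeries_ext _ _ t (im_series_scal z a)).
    rewrite PSeries_minus, PSeries_plus
      by (apply ex_pseries_scal; try assumption; apply Rmult_comm).
    rewrite !PSeries_scal.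
    reflexivity.
Qed.

Lemma locally_dilate (s : R) (P : R -> Prop) :
  locally 0%R P -> locally 0%R (fun t => P (s * t)%R).
Proof.
  intros HP.
  assert (Hc : filterlim (fun t : R => (s * t)%R) (locally 0%R) (locally (s * 0)%R)).
  { exact (filterlim_scal_r s (0%R : R_NormedModule)). }
  rewrite Rmult_0_r in Hc; exact (Hc P HP).
Qed.

Lemma real_expansion_dilate (s : R) (a : nat -> C) (g : R -> C) :
  s <> 0%R -> real_expansion a g ->
  real_expansion (fun n => RtoC (s ^ n) * a n) (fun t => g (s * t)%R).
Proof.
  intros Hs (Har & Hai & Ha).
  assert (Er : forall n, re_series (fun n => RtoC (s ^ n) * a n) n = (s ^ n * re_series a n)%R).
  { intros n; unfold re_series, Re; simpl; ring. }
  assert (Ei : forall n, im_series (fun n => RtoC (s ^ n) * a n) n = (s ^ n * im_series a n)%R).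
  { intros n; unfold im_series, Im; simpl; ring. }
  assert (Hrad : forall u : nat -> R, Rbar_lt 0 (CV_radius u) ->
    Rbar_lt 0 (CV_radius (fun n => s ^ n * u n)%R)).
  (* For small [t] the point [s * t] lies in the disk of [u], and the dilated series at [t] is the
     series of [u] at [s * t]. *)
  { intros u Hu; apply CV_radius_pos_of_locally, locally'_of_locally.
    generalize (locally_dilate s _ (locally_lt_CV_radius _ Hu)); apply filter_imp.
    intros t Ht; destruct (CV_radius_inside _ _ Ht) as [l Hl]; exists l.
    revert Hl; apply is_series_ext; intros n.
    change (pow_n (K := R_AbsRing) (s * t)%R n * u n = pow_n (K := R_AbsRing) t n * (s ^ n * u n))%R.
    rewrite (pow_n_pow (s * t)), (pow_n_pow t), Rpow_mult_distr; ring. }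
  assert (Hps : forall (u : nat -> R) t,
    PSeries (fun n => s ^ n * u n)%R t = PSeries u (s * t)).
  { intros u t; apply Series_ext; intros n; rewrite Rpow_mult_distr; ring. }
  split; [| split].
  - rewrite (CV_radius_ext _ _ Er); auto.
  - rewrite (CV_radius_ext _ _ Ei); auto.
  - destruct (locally_dilate s _ Ha) as [e He]; exists e; intros t Ht Hn.
    rewrite (PSeries_ext _ _ t Er), (PSeries_ext _ _ t Ei), !Hps.
    (* Since [s] is nonzero, [s * t] avoids the excluded point 0. *)
    apply (He t Ht); intros E; apply Rmult_integral in E; tauto.
Qed.

(** * Complex exponential, principal logarithm and principal powers *)

Lemma Cexp_plus (z w : C) : Cexp (z + w) = Cexp z * Cexp w.
Proof.
  unfold Cexp; destruct z as [a b], w as [a' b']; unfold Re, Im; simpl.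
  rewrite exp_plus, cos_plus, sin_plus.
  apply injective_projections; simpl; ring.
Qed.

Lemma Carg_real_pos (s : R) : (0 < s)%R -> Carg s = 0%R.
Proof.
  intros Hs; unfold Carg; rewrite Cmod_R, Rabs_pos_eq by lra; simpl.
  destruct (Rle_dec 0 0) as [_ | H]; [| lra].
  replace (s / s)%R with 1%R by (field; lra).
  apply acos_1.
Qed.

(** A positive real factor leaves the principal argument unchanged, so no multiple of 2 pi i
    appears. *)
Lemma Cln_mult_real_pos (s : R) (z : C) :
  (0 < s)%R -> z <> 0 -> Cln (s * z) = Cln s + Cln z.
Proof.
  intros Hs Hz; apply Cmod_gt_0 in Hz.
  apply injective_projections; simpl.
  - rewrite Cmod_mult, Cmod_R, Rabs_pos_eq by lra; apply ln_mult; assumption.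
  - rewrite Carg_real_pos, Rplus_0_l by assumption.
    unfold Carg; rewrite Cmod_mult, Cmod_R, Rabs_pos_eq by lra.
    replace (Re (s * z)) with (s * Re z)%R by (unfold Re; simpl; ring).
    replace (Im (s * z)) with (s * Im z)%R by (unfold Im; simpl; ring).
    replace (s * Re z / (s * Cmod z))%R with (Re z / Cmod z)%R by (field; lra).
    (* Scaling by [s > 0] keeps the sign of the imaginary part, so both arguments use the same
       branch. *)
    destruct (Rle_dec 0 (Im z)) as [H | H], (Rle_dec 0 (s * Im z)) as [H' | H'];
      try reflexivity; exfalso; nra.
Qed.

Lemma Cpower_mult_real_pos (s : R) (z w : C) :
  (0 < s)%R -> z <> 0 -> Cpower (s * z) w = Cpower s w * Cpower z w.
Proof.
  intros Hs Hz; unfold Cpower.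
  rewrite Cln_mult_real_pos, Cmult_plus_distr_l, Cexp_plus by assumption; reflexivity.
Qed.

Lemma Cexp_ln_nat (s : R) (k : nat) : (0 < s)%R -> Cexp (INR k * Cln s) = s ^ k.
Proof.
  intros Hs.
  rewrite <- RtoC_pow, <- Rpower_pow by assumption.
  unfold Cexp, Cln; rewrite Carg_real_pos, Cmod_R, Rabs_pos_eq by (assumption || lra).
  unfold Rpower, Re, Im; simpl.
  replace (INR k * ln s - 0 * 0)%R with (INR k * ln s)%R by ring.
  replace (INR k * 0 + 0 * ln s)%R with 0%R by ring.
  rewrite cos_0, sin_0.
  apply injective_projections; simpl; ring.
Qed.

(** Splits d^(nu+k) into the constant d^nu, a prefactor of the whole product, and d^k, which comes
    from dilating by d. *)
Lemma Cpower_plus_nat (s : R) (w : C) (k : nat) :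
  (0 < s)%R -> Cpower s (w + INR k) = Cpower s w * s ^ k.
Proof.
  intros Hs; unfold Cpower.
  rewrite Cmult_plus_distr_r, Cexp_plus, Cexp_ln_nat by assumption; reflexivity.
Qed.

(* Holds at z = 0 too, since there both inverses are 0. *)
Lemma Cinv_opp (z : C) : / - z = - / z.
Proof.
  assert (E : (fst (- z)%C ^ 2 + snd (- z)%C ^ 2 = fst z ^ 2 + snd z ^ 2)%R) by (simpl; ring).
  unfold Cinv, Rdiv; rewrite E; apply injective_projections; simpl; ring.
Qed.

(** * The two sides as coefficients of one symmetric function *)

Lemma gen_power_sum_function (p : nat) (lam t : C) :
  (0 < p)%nat ->
  (- lam * Cexp (INR (p - 1 + 1) * t) - 1) / (- lam * Cexp t - 1) =
  (lam * Cexp (INR p * t) + 1) / (lam * Cexp t + 1).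
Proof.
  intros Hp; rewrite Nat.sub_add by exact Hp.
  (* Numerator and denominator both change sign; [Cinv_opp] carries the sign through the inverse
     even where the denominator vanishes. *)
  replace (- lam * Cexp t - 1) with (- (lam * Cexp t + 1)) by ring.
  unfold Cdiv; rewrite Cinv_opp; ring.
Qed.

(** The three inverse factorials are those of the exponential generating functions in the triple
    product. *)
Lemma multinomial_coef (n k l : nat) :
  (k <= n)%nat -> (l <= k)%nat ->
  RtoC (Binomial.C n k) * RtoC (Binomial.C k l) =
  INR (fact n) * (/ INR (fact (n - k)) * (/ INR (fact l) * / INR (fact (k - l)))).
Proof.
  intros Hk Hl.
  rewrite <- !RtoC_inv, <- !RtoC_mult by apply INR_fact_neq_0; f_equal.
  unfold Binomial.C; field; repeat split; apply INR_fact_neq_0.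
Qed.

(** Here [(p, q)] stands for (c, d) or (d, c), and the orders are [1 + m] and [m]. The closed form
    is arranged so that exchanging [p] and [q] only permutes factors: the prefactor q^nu raises the
    exponent of q^nu from [m] to [1 + m], and the denominator of the power sum does the same for
    that of [lam * Cexp (INR q * t) + 1]. *)
Lemma real_expansion_symmetry_side (r p q m : nat) (lam mu nu x y X Y : C)
    (A B S : nat -> C) :
  (0 < p)%nat -> (0 < q)%nat ->
  is_egf A (fun t => ((Cpower 2 mu * Cpower t nu) / (lam * Cexp t + 1)) ^ (1 + m)
    * (Cexp (INR q * x * t) / (1 - INR q ^ r * y * t ^ r))) ->
  is_egf B (fun t => ((Cpower 2 mu * Cpower t nu) / (lam * Cexp t + 1)) ^ m
    * (Cexp (INR p * X * t) / (1 - INR p ^ r * Y * t ^ r))) ->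
  is_gen_power_sum (p - 1) (- lam) S ->
  real_expansion
    (fun n => / INR (fact n) * sum_n (fun k : nat => sum_n (fun l : nat =>
      Binomial.C n k * Binomial.C k l * INR p ^ (n - k) * Cpower (INR q) (nu + INR k)
      * A (n - k)%nat * S l * B (k - l)%nat) k) n)
    (fun t : R => (Cpower 2 mu * Cpower t nu) ^ (1 + 2 * m)
      * (Cpower (INR p) nu * Cpower (INR q) nu) ^ (1 + m)
      * (lam * Cexp (INR p * INR q * t) + 1)
      * ((/ (lam * Cexp (INR p * t) + 1)) * (/ (lam * Cexp (INR q * t) + 1))) ^ (1 + m)
      * (Cexp (INR p * INR q * x * t) * Cexp (INR p * INR q * X * t))
      / (1 - (INR p * INR q) ^ r * y * t ^ r) / (1 - (INR p * INR q) ^ r * Y * t ^ r)).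
Proof.
  intros Hp Hq HA HB HS.
  apply lt_0_INR in Hq as Hq'; apply lt_0_INR in Hp as Hp'.
  apply is_egf_real_expansion in HA, HB, HS.
  (* Dilation puts p^(n-k) on the coefficient of [A], and q^(k-l) and q^l on those of [B] and [S],
     together q^k. *)
  apply (real_expansion_dilate (INR p)) in HA; [| lra].
  apply (real_expansion_dilate (INR q)) in HB; [| lra].
  apply (real_expansion_dilate (INR q)) in HS; [| lra].
  generalize (real_expansion_scal (Cpower (INR q) nu) _ _
    (real_expansion_mult _ _ _ _ (real_expansion_mult _ _ _ _ HS HB) HA)).
  apply real_expansion_ext.
  - intros n; unfold Cconv.
    rewrite <- !(sum_n_mult_l (K := C_Ring)).
    apply sum_n_ext_loc; intros k Hk.
    rewrite <- (sum_n_mult_r (K := C_Ring)).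
    change (@mult C_Ring) with Cmult.
    rewrite <- !(sum_n_mult_l (K := C_Ring)).
    apply sum_n_ext_loc; intros l Hl.
    change (@mult C_Ring) with Cmult.
    rewrite multinomial_coef by assumption.
    rewrite Cpower_plus_nat by assumption.
    rewrite !RtoC_pow.
    replace (INR q ^ k) with (INR q ^ l * INR q ^ (k - l))
      by (rewrite <- Cpow_add_r; f_equal; lia).
    unfold Cdiv.
    match goal with |- ?a = ?b => change (@eq C a b) end.
    field; repeat split; intros E; apply RtoC_inj in E; revert E; apply INR_fact_neq_0.
  - intros t Ht.
    rewrite gen_power_sum_function by assumption.
    assert (HtC : RtoC t <> 0) by (intros E; apply Ht, RtoC_inj, E).
    rewrite !RtoC_mult, !Cpower_mult_real_pos by assumption.
    unfold Cdiv.
    rewrite !Cpow_mult_l.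
    (* The powers of 2^mu t^nu come [1 + m] times from [A] and [m] times from [B]. *)
    replace (2 * m)%nat with (m + m)%nat by lia.
    rewrite !Cpow_add_r, !Cpow_1_r.
    replace (INR p * (INR q * t)) with (INR p * INR q * t) by ring.
    replace (INR q * x * (INR p * t)) with (INR p * INR q * x * t) by ring.
    replace (INR p * X * (INR q * t)) with (INR p * INR q * X * t) by ring.
    replace (INR q ^ r * y * (INR p ^ r * t ^ r)) with (INR p ^ r * INR q ^ r * y * t ^ r) by ring.
    replace (INR p ^ r * Y * (INR q ^ r * t ^ r)) with (INR p ^ r * INR q ^ r * Y * t ^ r) by ring.
    ring.
Qed.

Theorem corollary3p5 :
  forall (r : nat) (hr : (0 < r)%nat)
    (c d : nat) (hc : (0 < c)%nat) (hd : (0 < d)%nat)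
    (n m : nat) (hm : (1 <= m)%nat)
    (lam mu nu : C)
    (F : nat -> nat -> C -> C -> C)
    (hF : is_trunc_exp_apostol r lam mu nu m (F m))
    (hF' : is_trunc_exp_apostol r lam mu nu (m - 1) (F (m - 1)%nat))
    (PS : nat -> C -> nat -> C)
    (hPS : forall (j : nat) (a : C), is_gen_power_sum j a (PS j a))
    (x y X Y : C),
  sum_n (fun k : nat => sum_n (fun l : nat =>
      Binomial.C n k * Binomial.C k l
      * INR c ^ (n - k) * Cpower (INR d) (nu + INR k)
      * F m (n - k)%nat (INR d * x) (INR d ^ r * y)
      * PS (c - 1)%nat (- lam) l
      * F (m - 1)%nat (k - l)%nat (INR c * X) (INR c ^ r * Y)) k) n
  =
  sum_n (fun k : nat => sum_n (fun l : nat =>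
      Binomial.C n k * Binomial.C k l
      * INR d ^ (n - k) * Cpower (INR c) (nu + INR k)
      * F m (n - k)%nat (INR c * x) (INR c ^ r * y)
      * PS (d - 1)%nat (- lam) l
      * F (m - 1)%nat (k - l)%nat (INR d * X) (INR d ^ r * Y)) k) n.
Proof.
  intros.
  (* From here on [m] denotes the lower of the two orders. *)
  destruct m as [| m]; [lia |].
  rewrite Nat.sub_succ, Nat.sub_0_r in *.
  assert (H1 := real_expansion_symmetry_side r c d m lam mu nu x y X Y _ _ _ hc hd
    (hF _ _) (hF' _ _) (hPS _ _)).
  assert (H2 := real_expansion_symmetry_side r d c m lam mu nu x y X Y _ _ _ hd hc
    (hF _ _) (hF' _ _) (hPS _ _)).
  (* Three commutations turn the function for (d, c) into the one for (c, d), so uniqueness of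
     coefficients applies. *)
  eapply real_expansion_ext in H2;
    [| intros; reflexivity
     | intros t _;
       rewrite (Cmult_comm (INR d) (INR c)), (Cmult_comm (Cpower (INR d) nu)),
         (Cmult_comm (/ (lam * Cexp (INR d * t) + 1)));
       reflexivity].
  assert (E := real_expansion_unique _ _ _ H1 H2 n); cbv beta in E.
  assert (Hn : RtoC (INR (fact n)) <> 0).
  { intros H; apply RtoC_inj in H; revert H; apply INR_fact_neq_0. }
  (* Multiplying by n! removes the normalisation of the n-th coefficient. *)
  apply (f_equal (Cmult (INR (fact n)))) in E.
  rewrite !Cmult_assoc, !Cinv_r, !Cmult_1_l in E by exact Hn.
  exact E.
Qed.
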